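(* Let $\epsilon > 0$, $X > 1$ and let $H$ be a real number with $X^{3\epsilon} \le H \le X^{1/2-\epsilon}$. For each $x$ put $y = y(x) = 2\sqrt{x}\,H + H^2$. Then $$Q(x+y) - Q(x) = \frac{\zeta(3/2)}{\zeta(3)} H + O_\epsilon\bigl( H^{8/11+\epsilon} \bigr)$$ for almost all $x \in [X, 2X]$.
   Context: A positive integer $n$ is squarefull if $p^2 \mid n$ for every prime $p \mid n$ (so $1$ is squarefull). $Q(x)$ denotes the number of squarefull positive integers $n \le x$. $\zeta$ is the Riemann zeta function. $O_\epsilon(g)$ denotes a quantity bounded in absolute value by $C g$ with $C > 0$ depending only on $\epsilon$. ''For almost all $x \in [X,2X]$'' means for all $x \in [X,2X]$ apart from a set of Lebesgue measure $o(X)$ as $X \to \infty$ (with $H$ allowed to vary with $X$ in the stated range). *)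

(* Defs.v *)
From mathcomp Require Export all_boot all_order all_algebra.
From mathcomp Require Export all_classical all_reals all_analysis.

Set Implicit Arguments.
Unset Strict Implicit.
Unset Printing Implicit Defensive.

Import Order.TTheory GRing.Theory Num.Theory.
Import numFieldNormedType.Exports.

Local Open Scope classical_set_scope.
Local Open Scope ring_scope.

Definition squarefull (n : nat) : bool :=
  ((0 < n) && all (fun p => p ^ 2 %| n) (primes n))%N.

Lemma squarefullP (n : nat) :
  reflect ((0 < n)%N /\ (forall p, prime p -> (p %| n -> p ^ 2 %| n)%N))
          (squarefull n).
Proof.
apply: (iffP andP) => -[n0 h]; split=> //.
  by move=> p pp pn; apply: (allP h); rewrite mem_primes pp n0.
by apply/allP => p; rewrite mem_primes => /and3P[pp _]; exact: h.
Qed.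

(* For a natural number n >= 1, n <= truncn x holds iff n%:R <= x. *)
Definition Q (R : realType) (x : R) : nat :=
  count squarefull (iota 1 (Num.truncn x)).

(* The Dirichlet series of the Riemann zeta function; meaningful for s > 1. *)
Definition zeta (R : realType) (s : R) : R :=
  limn (series (fun n : nat => n.+1%:R `^ (- s))).

(* "P X x holds for almost all x in [X, 2X]": the exceptional set has Lebesgue
   measure o(X) as X tends to +oo. *)
Definition for_almost_all_dyadic (R : realType) (P : R -> R -> Prop) : Prop :=
  forall d : R, 0 < d ->
    \forall X \near +oo,
      (lebesgue_measure [set x : R | (X <= x <= 2 * X)%R /\ ~ P X x]
         <= (d * X)%:E)%E.

(* Main.v *)
Require Import Defs.
From mathcomp Require Import all_boot all_order all_algebra.
From mathcomp Require Import all_classical all_reals all_analysis.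
From mathcomp Require Import measurable_realfun zify ring lra.
Import Order.TTheory GRing.Theory Num.Theory.
Import numFieldNormedType.Exports.
Local Open Scope ring_scope.

(** Every squarefull [n] is uniquely [a ^ 2 * b ^ 3] with [b] squarefree; here
[b] is recovered as the squarefree part [core n] of [n].  As
[x + y = (sqrt x + H) ^ 2], the squarefull numbers of core [b] in
[(x, x + y]] correspond to the integers [a] in an interval of length
[H / b ^ (3/2)], so their number differs from [H / b ^ (3/2)] by at most [1].
Cut at [b = K].

- The cores [b < K] contribute [H] times the partial sum of
  [b ^ (-3/2)] over squarefree [b], up to an error [K].  That partial sum
  misses [zeta (3/2) / zeta 3] by at most [4 / sqrt K]: multiplying the full
  sum over squarefree [b] by [zeta 3 = \sum_d (d ^ 2) ^ (-3/2)] gives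
  [zeta (3/2)], each [n] being [d ^ 2 * b] in one way ([zeta_ratio]).

- The cores [b >= K] are controlled on average.  There are at most
  [4 * sqrt M / sqrt K] such squarefull [n <= M], and each of them lies in
  [(x, x + y]] only for [x] in an interval of length [2 * H * sqrt M].  With [M]
  of size [X], Markov's inequality bounds the measure of those [x] in [[X, 2X]]
  for which more than [t] of them occur by a constant times
  [X * H / (t * sqrt K)] ([measure_Q_increment]).

With [H = V ^ 11], [K] close to [V ^ 8] and [t = V ^ 8 * H ^ eps], the two
deterministic errors are [O(V ^ 8)] because [H / sqrt K] is [O(V ^ 7)], and the
exceptional measure is [O(X * H ^ (- eps))], which is [o(X)] because [H] is at
least [X ^ (3 * eps)]. *)

(** * Squarefree cores *)

Definition squarefree (n : nat) : bool :=
  ((0 < n) && all (fun p => logn p n <= 1) (primes n))%N.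

Lemma squarefree_logn n p : squarefree n -> (logn p n <= 1)%N.
Proof.
move=> /andP[n0 /allP h].
have [/h //|] := boolP (p \in primes n).
by rewrite -logn_gt0 -leqNgt => /leq_trans; apply.
Qed.

Definition square_part (n : nat) : nat := (\max_(d < n.+1 | d ^ 2 %| n) d)%N.

Definition core (n : nat) : nat := (n %/ square_part n ^ 2)%N.

(** The square part being maximal, a prime whose square divided the core could
be moved into it. *)
Lemma square_part_core n : (0 < n)%N ->
  [/\ n = (square_part n ^ 2 * core n)%N, squarefree (core n) &
      (0 < square_part n)%N].
Proof.
move=> n0.
have n1 : (1 < n.+1)%N by [].
have [|[d hd] dn dE] := @eq_bigmax_cond _ (fun d : 'I_n.+1 => (d ^ 2 %| n)%N) val.
  by apply/card_gt0P; exists (Ordinal n1); rewrite unfold_in /= dvd1n.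
have {}dn : (d ^ 2 %| n)%N := dn.
rewrite /core.
have -> : square_part n = d by rewrite /square_part dE.
have d0 : (0 < d)%N by case: (posnP d) dn => // ->; rewrite dvd0n => /eqP n_0; rewrite n_0 in n0.
have nE : n = (d ^ 2 * (n %/ d ^ 2))%N by rewrite mulnC divnK.
have c0 : (0 < n %/ d ^ 2)%N by move: n0; rewrite {1}nE muln_gt0 => /andP[].
split=> //; rewrite /squarefree c0 /=; apply/allP => p.
rewrite mem_primes => /and3P[pp _ pc]; rewrite leqNgt; apply/negP => p2.
have pdn : ((p * d) ^ 2 %| n)%N.
  by rewrite nE expnMn mulnC dvdn_mul // pfactor_dvdn.
have pdlt : (p * d < n.+1)%N.
  rewrite ltnS (leq_trans _ (dvdn_leq n0 pdn)) //.
  by rewrite leq_pmulr // muln_gt0 d0 prime_gt0.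
have := @leq_bigmax_cond _ (fun d : 'I_n.+1 => (d ^ 2 %| n)%N) val (Ordinal pdlt) pdn.
rewrite dE /= leqNgt => /negP; apply.
by rewrite ltn_Pmull // prime_gt1.
Qed.

(** The valuations of [b] and [d] are [0] or [1], and those of [a ^ 2] and
[c ^ 2] are even, so parity determines [b] and [d] prime by prime. *)
Lemma squarefree_mul_inj a b c d : (0 < a)%N -> (0 < c)%N ->
  squarefree b -> squarefree d -> (a ^ 2 * b = c ^ 2 * d)%N -> a = c /\ b = d.
Proof.
move=> a0 c0 sb sd E.
have b0 : (0 < b)%N by case/andP: sb.
have d0 : (0 < d)%N by case/andP: sd.
have bd : b = d.
  apply: eqn_from_log => // p.
  have := congr1 (logn p) E; rewrite lognM ?expn_gt0 ?a0 // lognX lognM ?expn_gt0 ?c0 // lognX.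
  have := squarefree_logn b p sb; have := squarefree_logn d p sd; lia.
split=> //; move/eqP: E; rewrite bd eqn_pmul2r // eqn_exp2r // => /eqP.
by [].
Qed.

Lemma core_unique a b : (0 < a)%N -> squarefree b -> core (a ^ 2 * b) = b.
Proof.
move=> a0 sb.
have b0 : (0 < b)%N by case/andP: sb.
have n0 : (0 < a ^ 2 * b)%N by rewrite muln_gt0 expn_gt0 a0 b0.
have [E sc s0] := square_part_core _ n0.
by have [] := squarefree_mul_inj _ _ _ _ a0 s0 sb sc E.
Qed.

Lemma core_le n : (core n <= n)%N.
Proof. exact: leq_div. Qed.

(** A prime dividing the core has odd valuation in [n].  Squarefullness excludes
valuation [1], so that prime also divides the square part; hence the core divides
the square part, which supplies the two missing factors of [core n ^ 3]. *)
Lemma squarefull_coreP n :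
  reflect (exists2 a, (0 < a)%N & n = (a ^ 2 * core n ^ 3)%N /\ squarefree (core n))
          (squarefull n).
Proof.
apply: (iffP (squarefullP _)) => [[n0 h]|[a a0 [nE sc]]].
  have [nE sc s0] := square_part_core _ n0.
  have c0 : (0 < core n)%N by case/andP: sc.
  have cs : (core n %| square_part n)%N.
    apply/(dvdn_partP _ c0) => p /[!mem_primes]/and3P[pp _ pc].
    have l1 : logn p (core n) = 1%N.
      apply/eqP; rewrite eqn_leq squarefree_logn // logn_gt0 mem_primes.
      by rewrite pp c0.
    rewrite p_part l1 expn1.
    have pn : (p %| n)%N by rewrite nE dvdn_mull.
    have := h _ pp pn; rewrite pfactor_dvdn // {1}nE lognM ?expn_gt0 ?s0 // lognX l1 => l2.
    have : (0 < logn p (square_part n))%N by lia.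
    by rewrite logn_gt0 mem_primes => /and3P[].
  exists (square_part n %/ core n)%N; first by rewrite divn_gt0 // dvdn_leq.
  split=> //; rewrite {1}nE -{1}(divnK cs) expnMn.
  by rewrite -mulnA -expnSr.
have c0 : (0 < core n)%N by case/andP: sc.
split=> [|p pp]; first by rewrite nE muln_gt0 !expn_gt0 a0 c0.
rewrite nE Euclid_dvdM // !Euclid_dvdX // !andbT => /orP[pa|pc].
  by rewrite dvdn_mulr // dvdn_exp2r.
by rewrite dvdn_mull // (dvdn_trans (dvdn_exp2l p (isT : (2 <= 3)%N))) // dvdn_exp2r.
Qed.

Lemma squarefull_core_eqP b n : squarefree b ->
  reflect (exists2 a, (0 < a)%N & n = (a ^ 2 * b ^ 3)%N)
          (squarefull n && (core n == b)).
Proof.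
move=> sb; have b0 : (0 < b)%N by case/andP: sb.
apply: (iffP andP) => [[/squarefull_coreP[a a0 [nE _]] /eqP cb]|[a a0 nE]].
  by exists a => //; rewrite nE cb.
have cb : core n = b.
  have -> : n = ((a * b) ^ 2 * b)%N by rewrite nE expnMn -mulnA -expnSr.
  by rewrite core_unique // muln_gt0 a0.
by rewrite cb eqxx; split=> //; apply/squarefull_coreP; exists a => //; rewrite cb.
Qed.

(** * The series of b^(-3/2) *)

(** This is [b ^ (- 3 / 2)] for [b > 0]; integer powers of a square root keep its
algebra within reach of [field] and [nra]. *)
Definition weight (R : realType) (b : nat) : R := (Num.sqrt b%:R)^-1 ^+ 3.

Lemma weight_ge0 (R : realType) b : 0 <= weight R b.
Proof. by rewrite exprn_ge0 // invr_ge0 sqrtr_ge0. Qed.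

Lemma weight_powR (R : realType) b : weight R b.+1 = b.+1%:R `^ (- (3 / 2)).
Proof.
rewrite /weight powRN mulrC powRrM powR12_sqrt // powR_mulrn ?sqrtr_ge0 //.
by rewrite exprVn.
Qed.

Lemma weight_square_mul (R : realType) d b :
  weight R (d ^ 2 * b) = d%:R^-1 ^+ 3 * weight R b.
Proof.
rewrite /weight natrM sqrtrM ?ler0n // natrX sqrtr_sqr ger0_norm //.
by rewrite invfM exprMn.
Qed.

(** With [r] and [s] the square roots of [b] and [b + 1], so that
[(s - r) * (s + r) = 1], the claim becomes [s * (s + r) <= 4 * r ^ 2], which
follows from [s <= 3 / 2 * r]; it makes the tail of the series telescope. *)
Lemma weight_le_diff (R : realType) b : (0 < b)%N ->
  weight R b <= 4 * ((Num.sqrt b%:R)^-1 - (Num.sqrt b.+1%:R)^-1).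
Proof.
move=> b0; rewrite /weight.
have r0 : 1 <= Num.sqrt b%:R :> R.
  by rewrite -[leLHS]sqrtr1 ler_sqrt // ler1n.
have s0 : 1 <= Num.sqrt b.+1%:R :> R.
  by rewrite -[leLHS]sqrtr1 ler_sqrt // ler1n.
have sE : Num.sqrt b.+1%:R ^+ 2 = Num.sqrt b%:R ^+ 2 + 1 :> R.
  by rewrite !sqr_sqrtr // natr1.
move: (Num.sqrt b%:R) (Num.sqrt b.+1%:R) r0 s0 sE => r s r1 s1 sE.
have rn0 : r != 0 by rewrite gt_eqF //; lra.
have sn0 : s != 0 by rewrite gt_eqF //; lra.
have -> : r^-1 - s^-1 = (s - r) / (r * s) by field; rewrite rn0 sn0.
rewrite exprVn mulrA ler_pdivlMr; last by rewrite mulr_gt0 //; lra.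
rewrite mulrC ler_pdivrMr; last by rewrite exprn_gt0 //; lra.
have sr : r <= s by nra.
(* [b >= 1] gives [s ^ 2 <= 2 * r ^ 2], and [2 <= (3 / 2) ^ 2]. *)
have s2r : s <= 3 / 2 * r by nra.
have E : (s - r) * (s + r) = 1 by rewrite -subr_sqr sE; ring.
have -> : r * s = (s - r) * r * (s * (s + r)) by rewrite -[LHS]mulr1 -E; ring.
have -> : 4 * (s - r) * r ^+ 3 = (s - r) * r * (4 * r ^+ 2) by ring.
by rewrite ler_wpM2l //; nra.
Qed.

Lemma weight_tail (R : realType) K M : (0 < K)%N ->
  \sum_(K <= b < M) weight R b <= 4 / Num.sqrt K%:R.
Proof.
move=> K0; have [KM|MK] := leqP K M; last first.
  by rewrite big_geq ?(ltnW MK) // divr_ge0 // sqrtr_ge0.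
have le_sum : \sum_(K <= b < M) weight R b <=
    4 * \sum_(K <= b < M) (- (Num.sqrt b.+1%:R)^-1 - - (Num.sqrt b%:R)^-1).
  rewrite mulr_sumr big_nat [leRHS]big_nat ler_sum // => b /andP[Kb _].
  by rewrite opprK addrC weight_le_diff // (leq_trans K0).
apply: le_trans le_sum _; rewrite (telescope_sumr (fun b => - (Num.sqrt b%:R)^-1)) //.
rewrite opprK ler_pM2l // gerDr oppr_le0 invr_ge0 sqrtr_ge0 //.
Qed.

(** * The constant zeta(3/2)/zeta(3) *)

Lemma nneg_series_lim (R : realType) (u : nat -> R) (M : R) :
  (forall n, 0 <= u n) -> (forall N, series u N <= M) ->
  (forall N, series u N <= limn (series u)) /\ limn (series u) <= M.
Proof.
move=> u0 uM.
have nd : {homo series u : m n / (m <= n)%N >-> m <= n}.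
  by apply/nondecreasing_seqP => n; rewrite !seriesEnat /= big_nat_recr //= lerDl.
have cv : cvgn (series u).
  by apply: nondecreasing_is_cvgn => //; exists M => _ [N _ <-].
split; first exact: nondecreasing_cvgn_le.
by apply: limr_le => //; near=> n.
Unshelve. all: by end_near. Qed.

Lemma series_shift (R : realType) (u : nat -> R) N :
  series (fun n => u n.+1) N = \sum_(1 <= n < N.+1) u n.
Proof. by rewrite seriesEnat /= big_add1. Qed.

Lemma sum_weight_le (R : realType) N : \sum_(1 <= n < N.+1) weight R n <= 4.
Proof. by apply: le_trans (weight_tail _ _ _ _) _ => //; rewrite sqrtr1 divr1. Qed.

(** The value at [3 / 2] as a supremum of partial sums; stated with both halves
because finite sums are compared to it from either side. *)
Lemma zeta32_bounds (R : realType) :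
  (forall N, \sum_(1 <= n < N.+1) weight R n <= zeta (3 / 2 : R)) /\
  (forall M, (forall N, \sum_(1 <= n < N.+1) weight R n <= M) -> zeta (3 / 2) <= M).
Proof.
have -> : zeta (3 / 2) = limn (series (fun n => weight R n.+1)).
  by rewrite /zeta; congr (limn (series _)); apply/funext => n; rewrite weight_powR.
split=> [N|M wM].
  rewrite -series_shift.
  have [//|+ _] := @nneg_series_lim _ (fun n => weight R n.+1) 4 (fun n => weight_ge0 _ _).
    by move=> {}N; rewrite series_shift sum_weight_le.
  exact.
have [|//] := @nneg_series_lim _ (fun n => weight R n.+1) M (fun n => weight_ge0 _ _).
by move=> N; rewrite series_shift.
Qed.

Lemma zeta3_bounds (R : realType) :
  (forall N, \sum_(1 <= n < N.+1) n%:R^-1 ^+ 3 <= zeta (3 : R)) /\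
  (forall M : R, (forall N, \sum_(1 <= n < N.+1) n%:R^-1 ^+ 3 <= M) -> zeta 3 <= M).
Proof.
pose c n : R := n%:R^-1 ^+ 3.
have c0 n : 0 <= c n by rewrite exprn_ge0 // invr_ge0.
have -> : zeta (3 : R) = limn (series (fun n => c n.+1)).
  rewrite /zeta; congr (limn (series _)); apply/funext => n.
  by rewrite /c powRN powR_mulrn // exprVn.
split=> [N|M cM].
  rewrite -(series_shift _ c).
  have [//||+ _] := @nneg_series_lim _ (fun n => c n.+1) 4; last exact.
  move=> {}N; rewrite series_shift; apply: le_trans (sum_weight_le R N).
  rewrite big_nat [leRHS]big_nat ler_sum // => n /andP[n0 _].
  rewrite lerXn2r ?nnegrE ?invr_ge0 ?sqrtr_ge0 // lef_pV2 ?posrE ?sqrtr_gt0 ?ltr0n //.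
  rewrite -{2}(sqr_sqrtr (ler0n R n)) expr2 ler_peMr ?sqrtr_ge0 //.
  by rewrite -[leLHS]sqrtr1 ler_sqrt // ler1n.
have [//||//] := @nneg_series_lim _ (fun n => c n.+1) M.
by move=> N; rewrite (series_shift _ c).
Qed.

Definition squarefree_sum (R : realType) (K : nat) : R :=
  \sum_(0 <= b < K | squarefree b) weight R b.

Lemma squarefree_sum_mul (R : realType) K L :
  squarefree_sum R K * \sum_(1 <= d < L.+1) d%:R^-1 ^+ 3 =
  \sum_(n <- [seq (d ^ 2 * b)%N | b <- [seq b <- iota 0 K | squarefree b],
                                  d <- iota 1 L]) weight R n.
Proof.
rewrite big_allpairs_dep big_filter /squarefree_sum /index_iota subn0 mulr_suml.
apply: eq_bigr => b _; rewrite mulr_sumr subSS subn0.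
by apply: eq_bigr => d _; rewrite weight_square_mul mulrC.
Qed.

Lemma uniq_square_mul K L :
  uniq [seq (d ^ 2 * b)%N | b <- [seq b <- iota 0 K | squarefree b], d <- iota 1 L].
Proof.
apply: (@allpairs_uniq _ _ _ (fun b d => d ^ 2 * b)%N); rewrite ?filter_uniq ?iota_uniq //.
move=> [b d] [b' d'] /allpairsP[[x y] /= [+ + [-> ->]]] /allpairsP[[x' y'] /= [+ + [-> ->]]].
rewrite !mem_filter !mem_iota => /andP[sx _] /andP[y0 _] /andP[sx' _] /andP[y0' _] E.
by have [-> ->] := squarefree_mul_inj _ _ _ _ y0 y0' sx sx' E.
Qed.

Lemma sum_weight_sub (R : realType) (s s' : seq nat) : uniq s -> uniq s' ->
  {subset s <= s'} -> \sum_(n <- s) weight R n <= \sum_(n <- s') weight R n.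
Proof.
move=> us us' ss'; rewrite [leRHS](bigID (mem s)) /= -[leLHS]addr0 lerD //; last first.
  by rewrite sumr_ge0 // => n _; exact: weight_ge0.
rewrite -[leRHS]big_filter (perm_big [seq n <- s' | n \in s]) //.
apply: uniq_perm; rewrite ?filter_uniq // => n; rewrite mem_filter.
by have [/ss'|] := boolP (n \in s).
Qed.

(** The products [d ^ 2 * b] are distinct, so the double sum is a subsum of the
series for [zeta (3 / 2)]. *)
Lemma squarefree_sum_le (R : realType) K :
  squarefree_sum R K * zeta 3 <= zeta (3 / 2).
Proof.
have S0 : 0 <= squarefree_sum R K by rewrite sumr_ge0 // => b _; exact: weight_ge0.
have [->|Sn0] := eqVneq (squarefree_sum R K) 0.
  rewrite mul0r.
  have [+ _] := zeta32_bounds R; move=> /(_ 0%N); by rewrite big_geq.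
have S_gt0 : 0 < squarefree_sum R K by rewrite lt_def Sn0.
rewrite mulrC -ler_pdivlMr //; have [_] := zeta3_bounds R.
apply=> L; rewrite ler_pdivlMr // mulrC squarefree_sum_mul.
have [+ _] := zeta32_bounds R; move=> /(_ (L ^ 2 * K)%N); apply: le_trans.
apply: sum_weight_sub; rewrite ?uniq_square_mul ?iota_uniq //.
move=> n /allpairsP[[b d] /= []]; rewrite mem_filter !mem_iota => /andP[sb bK] dL ->.
have b0 : (0 < b)%N by case/andP: sb.
move: bK dL; rewrite !add1n !ltnS /= add0n => bK /andP[d0 dL].
rewrite muln_gt0 expn_gt0 d0 b0 /=.
by rewrite subn1 leq_mul ?leq_exp2r // ltnW.
Qed.

Lemma zeta3_ge1 (R : realType) : 1 <= zeta (3 : R).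
Proof.
by have [/(_ 1%N) + _] := zeta3_bounds R; rewrite big_nat1 invr1 expr1n.
Qed.

(** The lower bound is [squarefree_sum_le].  For the upper bound, every [n <= N]
is some [d ^ 2 * b] with [b, d <= N], so [zeta (3 / 2)] is at most [zeta 3] times
the supremum of the squarefree sums, and the sum up to [K] misses that supremum by
at most the tail of the weights. *)
Lemma zeta_ratio (R : realType) K : (0 < K)%N ->
  squarefree_sum R K <= zeta (3 / 2) / zeta 3 <= squarefree_sum R K + 4 / Num.sqrt K%:R.
Proof.
move=> K0; have z3 := zeta3_ge1 R; have z3_gt0 : 0 < zeta (3 : R) by lra.
rewrite ler_pdivlMr // squarefree_sum_le /= ler_pdivrMr //.
have [_] := zeta32_bounds R; apply=> N.
have S_le : squarefree_sum R N.+1 <= squarefree_sum R K + 4 / Num.sqrt K%:R.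
  have [NK|KN] := leqP N.+1 K.
    rewrite -[leLHS]addr0 lerD ?divr_ge0 ?sqrtr_ge0 //.
    rewrite /squarefree_sum (big_cat_nat (leq0n _) NK) //= lerDl sumr_ge0 // => b _.
    exact: weight_ge0.
  rewrite {1}/squarefree_sum (big_cat_nat (leq0n _) (ltnW KN)) //= lerD2l.
  apply: le_trans (weight_tail _ _ N.+1 K0); rewrite [leLHS]big_mkcond ler_sum // => b _.
  by case: ifP => // _; exact: weight_ge0.
have [z3N _] := zeta3_bounds R.
apply: le_trans (ler_pM _ _ S_le (z3N N)); last 2 first.
- by rewrite sumr_ge0 // => b _; exact: weight_ge0.
- by rewrite sumr_ge0 // => b _; rewrite exprn_ge0 // invr_ge0.
rewrite squarefree_sum_mul; apply: sum_weight_sub; rewrite ?uniq_square_mul ?iota_uniq //.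
move=> n; rewrite mem_iota subn1 add1n ltnS => /andP[n0 nN].
have [nE sc d0] := square_part_core _ n0.
apply/allpairsP; exists (core n, square_part n); split=> //=.
  by rewrite mem_filter sc mem_iota (leq_ltn_trans (core_le _)) ?andbT; case/andP: sc.
rewrite mem_iota d0 add1n ltnS (leq_trans _ nN) // {2}nE.
have c0 : (0 < core n)%N by case/andP: sc.
by rewrite (leq_trans (leq_pexp2l d0 (isT : (1 <= 2)%N))) // leq_pmulr.
Qed.

(** * Counting squarefull numbers by core *)

(** The numbers counted are the [a ^ 2 * b ^ 3 <= z] with [a >= 1], that is
[a <= sqrt z / b ^ (3 / 2)]. *)
Lemma count_core (R : realType) (b : nat) (z : R) : 0 <= z -> squarefree b ->
  count (fun n => squarefull n && (core n == b)) (iota 1 (Num.truncn z)) =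
  Num.truncn (Num.sqrt z * weight R b).
Proof.
move=> z0 sb; have b0 : (0 < b)%N by case/andP: sb.
set m := Num.truncn (_ * _).
have w0 : 0 <= Num.sqrt z * weight R b by rewrite mulr_ge0 ?sqrtr_ge0 ?weight_ge0.
have le_m a : (a <= m)%N = (a ^ 2 * b ^ 3 <= Num.truncn z)%N.
  rewrite !truncn_ge_nat // /weight exprVn ler_pdivlMr; last first.
    by rewrite exprn_gt0 // sqrtr_gt0 ltr0n.
  rewrite -ler_sqr ?nnegrE ?sqrtr_ge0 ?mulr_ge0 ?exprn_ge0 ?sqrtr_ge0 //.
  by rewrite sqr_sqrtr // exprMn -exprM mulnC exprM sqr_sqrtr // natrM !natrX.
rewrite -size_filter -[RHS](size_iota 1) -[RHS](size_map (fun a => a ^ 2 * b ^ 3)%N).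
apply/perm_size/uniq_perm; first by rewrite filter_uniq // iota_uniq.
  rewrite map_inj_uniq ?iota_uniq // => x y /eqP.
  by rewrite eqn_pmul2r ?expn_gt0 ?b0 // eqn_exp2r // => /eqP.
move=> n; rewrite mem_filter mem_iota add1n ltnS; apply/idP/idP.
  move=> /and3P[/(squarefull_core_eqP _ _ sb)[a a0 ->] _ nz].
  by apply: map_f; rewrite mem_iota a0 add1n ltnS le_m.
move=> /mapP[a]; rewrite mem_iota add1n ltnS => /andP[a0 am] ->.
apply/and3P; split; last by rewrite -le_m.
  by apply/(squarefull_core_eqP _ _ sb); exists a.
by rewrite muln_gt0 !expn_gt0 a0 b0.
Qed.

(** A squarefull number has a squarefree core, so restricting the sum to squarefree [b] loses
nothing. *)
Lemma count_core_split (s : seq nat) (K L : nat) : (K <= L)%N ->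
  count (fun n => squarefull n && (K <= core n)%N) s =
  (\sum_(K <= b < L | squarefree b)
      count (fun n => squarefull n && (core n == b)) s +
   count (fun n => squarefull n && (L <= core n)%N) s)%N.
Proof.
elim: L => [|L IH]; first by rewrite leqn0 => /eqP ->; rewrite big_geq.
rewrite leq_eqVlt => /predU1P[->|KL]; first by rewrite big_geq.
rewrite big_mkcond big_nat_recr //= -big_mkcond /= IH // -addnA; congr addn.
have -> : (if squarefree L then count (fun n => squarefull n && (core n == L)) s else 0)
    = count (fun n => squarefull n && (core n == L)) s.
  case: ifPn => // nL; apply/esym/eqP; rewrite -leqn0 leqNgt -has_count.
  apply/hasPn => n _; apply/negP => /andP[/squarefull_coreP[a _ [_ +]] /eqP E].
  by rewrite E (negPf nL).
elim: s {IH} => //= n s ->.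
by case: (squarefull n) => //=; case: (ltngtP L (core n)); lia.
Qed.

Definition large_core (K n : nat) : bool := squarefull n && (K <= core n)%N.

Lemma Q_split (R : realType) (K : nat) (z : R) : 0 <= z ->
  Q z = (\sum_(0 <= b < K | squarefree b) Num.truncn (Num.sqrt z * weight R b) +
         count (large_core K) (iota 1 (Num.truncn z)))%N.
Proof.
move=> z0; have := count_core_split (iota 1 (Num.truncn z)) 0 K (leq0n _).
under eq_count do rewrite andbT.
rewrite /Q => ->; congr addn.
by apply: eq_bigr => b sb; rewrite count_core.
Qed.

(** Sum [count_core] over the cores from [K] on, without rounding down. *)
Lemma count_large_core_le (R : realType) (K : nat) (z : R) : (0 < K)%N -> 0 <= z ->
  (count (large_core K) (iota 1 (Num.truncn z)))%:R <= 4 * Num.sqrt z / Num.sqrt K%:R.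
Proof.
move=> K0 z0; pose L := maxn K (Num.truncn z).+1.
rewrite (count_core_split _ K L) ?leq_maxl //.
(* [L] exceeds every [n <= z], hence every core in play. *)
rewrite [X in (_ + X)%N](_ : _ = 0%N); last first.
  apply/eqP; rewrite -leqn0 leqNgt -has_count; apply/hasPn => n.
  rewrite mem_iota add1n ltnS => /andP[_ nz]; rewrite negb_and -ltnNge orbC.
  by rewrite leq_max ltnS (leq_trans (core_le _)) ?orbT.
rewrite addn0 natr_sum mulrAC mulrC.
apply: le_trans (ler_wpM2l (sqrtr_ge0 z) (weight_tail R K L K0)).
rewrite mulr_sumr big_mkcond ler_sum // => b _.
have zw : 0 <= Num.sqrt z * weight R b by rewrite mulr_ge0 ?sqrtr_ge0 ?weight_ge0.
by case: ifP => // sb; rewrite count_core //; have /andP[] := truncn_itv zw.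
Qed.

Lemma truncn_increment (R : realType) (a h : R) : 0 <= a -> 0 <= h ->
  `|(Num.truncn (a + h))%:R - (Num.truncn a)%:R - h| <= 1.
Proof.
move=> a0 h0; have /andP[] := truncn_itv a0.
have /andP[] := truncn_itv (addr_ge0 a0 h0).
rewrite -!natr1 ler_norml => *; apply/andP; split; lra.
Qed.

(** The deterministic part: below [K] each core costs a rounding error [1] and the
main term is cut off at the price of a tail, while the cores from [K] on are left
as the number of their squarefull numbers in the interval. *)
Lemma Q_increment (R : realType) (K : nat) (x H : R) : (0 < K)%N -> 0 <= x -> 0 <= H ->
  `|(Q ((Num.sqrt x + H) ^+ 2))%:R - (Q x)%:R - zeta (3 / 2) / zeta 3 * H| <=
  K%:R + 4 * H / Num.sqrt K%:R +
  ((count (large_core K) (iota 1 (Num.truncn ((Num.sqrt x + H) ^+ 2))))%:R -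
   (count (large_core K) (iota 1 (Num.truncn x)))%:R).
Proof.
move=> K0 x0 H0; have s0 := sqrtr_ge0 x; set z := (_ + H) ^+ 2.
have sz : Num.sqrt z = Num.sqrt x + H by rewrite sqrtr_sqr ger0_norm ?addr_ge0.
have z0 : 0 <= z by exact: sqr_ge0.
have xz : x <= z by rewrite -[leLHS]sqr_sqrtr // ler_sqr ?nnegrE ?addr_ge0 // lerDl.
rewrite (Q_split _ K _ z0) (Q_split _ K _ x0) sz !natrD.
set Tz := count _ _; set Tx := count _ _.
have TxTz : Tx%:R <= Tz%:R :> R.
  by rewrite ler_nat /Tz -(subnKC (le_truncn xz)) iotaD count_cat leq_addr.
set Sz := (\sum_(_ <= _ < _ | _) _)%N; set Sx := (\sum_(_ <= _ < _ | _) _)%N.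
have S_le : `|Sz%:R - Sx%:R - squarefree_sum R K * H| <= K%:R.
  rewrite /Sz /Sx !natr_sum /squarefree_sum mulr_suml -!sumrB.
  apply: le_trans (ler_norm_sum _ _ _) _.
  apply: (@le_trans _ _ (\sum_(0 <= b < K) 1)); last by rewrite big_mkord sumr_const card_ord.
  rewrite big_mkcond ler_sum // => b _; case: ifP => // _.
  rewrite mulrDl (mulrC (weight R b)) truncn_increment ?mulr_ge0 ?weight_ge0 //.
have [/andP[cl cu]] := zeta_ratio R K K0.
have cS : `|squarefree_sum R K * H - zeta (3 / 2) / zeta 3 * H| <= 4 * H / Num.sqrt K%:R.
  rewrite -mulrBl normrM (ger0_norm H0) mulrAC ler_wpM2r //.
  by rewrite ler0_norm ?subr_le0 // opprB lerBlDl.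
rewrite (_ : _ - _ = (Sz%:R - Sx%:R - squarefree_sum R K * H) +
   (squarefree_sum R K * H - zeta (3 / 2) / zeta 3 * H) + (Tz%:R - Tx%:R)); last by ring.
apply: le_trans (ler_normD _ _) _; apply: lerD; last by rewrite ger0_norm ?subr_ge0.
by apply: le_trans (ler_normD _ _) _; exact: lerD.
Qed.

(** * Large cores on average *)

(** Monotonicity with no measurability assumption, as the Lebesgue measure is
given on all sets by an outer measure. *)
Lemma lebesgue_measure_le_subset (R : realType) (A B : set R) :
  (A `<=` B)%classic -> (lebesgue_measure A <= lebesgue_measure B)%E.
Proof.
exact: (@le_outer_measure _ _ ((wlength (idfun : R -> R))^*)%mu).
Qed.

(** Markov's inequality for the number of sets [A i] that contain a point, whose
integral is the sum of their measures. *)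
Lemma markov_count d (T : measurableType d) (R : realType)
    (mu : {measure set T -> \bar R}) (I : Type) (s : seq I) (A : I -> set T)
    (m t : R) :
  (forall i, measurable (A i)) -> (forall i, mu (A i) <= m%:E)%E -> 0 < t ->
  (mu [set x | (t <= (count (fun i => x \in A i) s)%:R)%R]%classic
    <= ((size s)%:R * m / t)%:E)%E.
Proof.
move=> mA Am t0.
pose f : T -> \bar R := (fun x => \sum_(i <- s) (\1_(A i) x)%:E)%E.
have fE x : f x = ((count (fun i => x \in A i) s)%:R)%:E.
  rewrite /f sumEFin -sum1_count natr_sum [in RHS]big_mkcond /=; congr _%:E.
  by apply: eq_bigr => i _; rewrite indicE; case: (_ \in _).
have mf : measurable_fun [set: T]%classic f.
  by apply: emeasurable_sum => i; apply/measurable_EFinP/measurable_indic.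
have f0 x : (0 <= f x)%E by rewrite fE lee_fin.
have int_f : (\int[mu]_x f x <= ((size s)%:R * m)%:E)%E.
  rewrite ge0_integral_sum //; last first.
    by move=> i; apply/measurable_EFinP/measurable_indic.
  under eq_bigr do rewrite integral_indic // setIT.
  elim: s {f fE mf f0} => [|i s IH]; first by rewrite big_nil mul0r.
  by rewrite big_cons /= -natr1 mulrDl mul1r addrC EFinD leeD.
have := @le_integral_comp_abse _ _ _ mu setT measurableT f t id
  (@measurable_id _ _ setT) (fun r r0 => r0) (fun x y _ _ xy => xy) mf t0.
under eq_integral do rewrite gee0_abs //.
rewrite setTI => le_f.
have -> : [set x | (t <= (count (fun i => x \in A i) s)%:R)%R]%classic =
  [set x | (t%:E <= `|f x|)%E]%classic.
  by apply/seteqP; split=> x /=; rewrite gee0_abs // fE lee_fin.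
by rewrite EFinM lee_pdivlMr // muleC (le_trans le_f).
Qed.

(** Seen from [n], the condition [x < n <= (sqrt x + H) ^ 2] confines [x] to an
interval of length [2 * H * r], since
[n - x <= H * (2 * sqrt x + H) <= 2 * H * (sqrt x + H)].  The length is the same for
all [n], and the list of the [n] does not depend on [x]. *)
Lemma count_large_core_interval (R : realType) (K : nat) (x H r : R) :
  0 <= x -> 0 <= H -> Num.sqrt x + H <= r ->
  (count (large_core K) (iota 1 (Num.truncn ((Num.sqrt x + H) ^+ 2)%R)) <=
   count (large_core K) (iota 1 (Num.truncn x)) +
   count (fun n : nat => x \in `[(n%:R - 2 * H * r)%R, n%:R%R[%classic)
     [seq n <- iota 1 (Num.truncn (r ^+ 2)%R) | large_core K n])%N.
Proof.
move=> x0 H0 Hr; have s0 := sqrtr_ge0 x; set z := (_ + H) ^+ 2.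
have z0 : 0 <= z by exact: sqr_ge0.
have xz : x <= z by rewrite -[leLHS]sqr_sqrtr // ler_sqr ?nnegrE ?addr_ge0 // lerDl.
have zr : z <= r ^+ 2 by rewrite ler_sqr ?nnegrE ?addr_ge0 // (le_trans _ Hr) ?addr_ge0.
(* Both counts run over the one list of the [n <= r ^ 2], cut at [z] and at [x]. *)
have cutE (y : R) : 0 <= y -> y <= r ^+ 2 -> count (large_core K) (iota 1 (Num.truncn y)) =
    count (fun n => n%:R <= y) [seq n <- iota 1 (Num.truncn (r ^+ 2)) | large_core K n].
  move=> y0 yr; rewrite -(subnKC (le_truncn yr)) iotaD filter_cat count_cat.
  rewrite [X in (_ + X)%N](_ : _ = 0%N) ?addn0.
    rewrite -size_filter -[RHS]size_filter -filter_predI; congr size.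
    apply: eq_in_filter => n; rewrite mem_iota add1n ltnS => /andP[_ nT].
    by rewrite /= -truncn_ge_nat // nT.
  apply/eqP; rewrite -leqn0 leqNgt -has_count; apply/hasPn => n.
  rewrite mem_filter mem_iota add1n => /andP[_ /andP[nT _]].
  by rewrite -truncn_ge_nat // -ltnNge.
rewrite (cutE z) // (cutE x) // ?(le_trans xz) //.
elim: [seq _ <- _ | _] => //= n s IH.
have cover : n%:R <= z -> (n%:R <= x) || (x \in `[n%:R - 2 * H * r, n%:R[%classic).
  move=> nz; case: leP => //= xn; rewrite inE /= in_itv /= xn andbT.
  by have := sqr_sqrtr x0; move: nz; rewrite /z; nra.
move: cover IH; case: (n%:R <= z) => [/(_ isT)|_]; last by lia.
by case: (n%:R <= x); case: (x \in _) => //= _; lia.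
Qed.

(** An [x] that violates the bound lies in at least [t] of the intervals attached to
the squarefull [n <= r ^ 2] of large core; there are at most [4 * r / sqrt K] of
these, each of length [2 * H * r]. *)
Lemma measure_Q_increment (R : realType) (K : nat) (X H t : R) :
  (0 < K)%N -> 0 <= X -> 0 <= H -> 0 < t ->
  (lebesgue_measure [set x : R | (X <= x <= 2 * X)%R /\
     ~ (`|(Q ((Num.sqrt x + H) ^+ 2))%:R - (Q x)%:R - zeta (3 / 2) / zeta 3 * H|
          <= K%:R + 4 * H / Num.sqrt K%:R + t)%R]%classic
   <= (8 * H * (Num.sqrt (2 * X) + H) ^+ 2 / (Num.sqrt K%:R * t))%:E)%E.
Proof.
move=> K0 X0 H0 t0; set r := Num.sqrt (2 * X) + H.
have r0 : 0 <= r by rewrite addr_ge0 ?sqrtr_ge0.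
pose s := [seq n <- iota 1 (Num.truncn (r ^+ 2)) | large_core K n].
pose J (n : nat) : set R := `[n%:R - 2 * H * r, n%:R[%classic.
have mJ n : (lebesgue_measure (J n) <= (2 * H * r)%:E)%E.
  rewrite lebesgue_measure_itv /=; case: ifP => _; last by rewrite lee_fin !mulr_ge0.
  by rewrite -EFinB lee_fin opprB addrC subrK.
apply: (le_trans (lebesgue_measure_le_subset _ _
  [set x : R | (t <= (count (fun n => x \in J n) s)%:R)%R]%classic _)).
  move=> x /= [/andP[Xx x2X]] far; rewrite leNgt; apply/negP => few; apply: far.
  have x0 : 0 <= x := le_trans X0 Xx.
  apply: le_trans (Q_increment R K x H K0 x0 H0) _; rewrite lerD2l lerBlDl.
  have Hr : Num.sqrt x + H <= r by rewrite lerD2r ler_sqrt // mulr_ge0.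
  have := count_large_core_interval R K x H r x0 H0 Hr.
  by rewrite -(ler_nat R) natrD => /le_trans; apply; rewrite lerD2l ltW.
have mJm n : measurable (J n : set (measurableTypeR R)) by exact: measurable_itv.
have := markov_count _ _ _ lebesgue_measure _ s J _ t mJm mJ t0.
move=> /le_trans; apply.
rewrite lee_fin size_filter.
have -> : 8 * H * r ^+ 2 / (Num.sqrt K%:R * t) = 4 * r / Num.sqrt K%:R * (2 * H * r) / t.
  by rewrite invfM; ring.
rewrite ler_wpM2r ?invr_ge0 ?(ltW t0) // ler_wpM2r ?mulr_ge0 //.
by have := count_large_core_le R K (r ^+ 2) K0 (sqr_ge0 r); rewrite sqrtr_sqr ger0_norm.
Qed.

(** * Choice of the cutoff *)

Lemma cutoff_bounds (R : realType) (V : R) : 1 <= V ->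
  let K := Num.truncn (V ^+ 8) in
  [/\ (0 < K)%N, K%:R <= V ^+ 8 & V ^+ 4 / 2 <= Num.sqrt K%:R].
Proof.
move=> V1 K; have V0 : 0 <= V by lra.
have V8 : 1 <= V ^+ 8 by rewrite exprn_ege1.
have K0 : (0 < K)%N by rewrite truncn_gt0.
have K1 : 1 <= K%:R :> R by rewrite ler1n.
have /andP[Kle] := truncn_itv (le_trans ler01 V8); rewrite -natr1 -/K => ltK.
split=> //; rewrite -ler_sqr ?nnegrE ?sqrtr_ge0 ?divr_ge0 ?exprn_ge0 // sqr_sqrtr //.
rewrite expr_div_n -exprM -natrX; lra.
Qed.

Lemma powR_reaches (R : realType) (a M X : R) : 0 < a -> 0 <= M ->
  M `^ a^-1 <= X -> M <= X `^ a.
Proof.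
move=> a0 M0 MX.
rewrite -[leLHS](powRr1 M0) -(mulVf (lt0r_neq0 a0)) powRrM.
by rewrite ge0_ler_powR ?nnegrE ?powR_ge0 ?(ltW a0) ?(le_trans _ MX) ?powR_ge0.
Qed.

Theorem corollary1 (R : realType) (eps : R) (eps_gt0 : 0 < eps) :
  exists C : R, 0 < C /\
    forall H : R -> R,
      (forall X : R, 1 < X -> X `^ (3 * eps) <= H X <= X `^ (1 / 2 - eps)) ->
      for_almost_all_dyadic (fun X x : R =>
        let y := 2 * Num.sqrt x * H X + H X ^+ 2 in
        `| (Q (x + y))%:R - (Q x)%:R - zeta (3 / 2) / zeta 3 * H X |
          <= C * H X `^ (8 / 11 + eps)).
Proof.
(* [K], [4 * H / sqrt K] and [t] are at most [t], [8 * t] and [t]. *)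
exists 10; split=> // H Hbounds d d0.
have a0 : 0 < 3 * eps * eps by rewrite !mulr_gt0.
pose X0 : R := Num.max 1 ((96 / d) `^ (3 * eps * eps)^-1).
(* Beyond [X0] the bound [96 * X / H ^ eps] below is at most [d * X]. *)
near=> X.
have : X0 < X by near: X; apply: nbhs_pinfty_gt; exact: num_real.
rewrite gt_max => /andP[X1 largeX].
have {largeX} : 96 / d <= X `^ (3 * eps * eps).
  by apply: powR_reaches; rewrite ?divr_ge0 // ltW.
have /andP[] := Hbounds X X1; move: (H X) => h h_ge h_le; rewrite powRrM => large.
have h1 : 1 <= h.
  by apply: le_trans h_ge; rewrite -[leLHS](powRr0 X) ler_powR ?ltW // mulr_gt0.
have h0 : 0 <= h by lra.
have hX : h <= Num.sqrt X.
  apply: le_trans h_le _; rewrite -powR12_sqrt; last lra.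
  rewrite ler_powR ?ltW //; lra.
have {large h_ge} large : 96 / d <= h `^ eps.
  by apply: le_trans large _; rewrite ge0_ler_powR ?nnegrE ?powR_ge0 ?(ltW eps_gt0).
pose V := h `^ 11^-1.
have V1 : 1 <= V.
  by rewrite -[leLHS](powRr0 h) ler_powR // invr_ge0.
have hV : h = V ^+ 11.
  by rewrite /V -powR_mulrn ?powR_ge0 // -powRrM mulVf // powRr1.
have tV : h `^ (8 / 11 + eps) = V ^+ 8 * h `^ eps.
  rewrite powRD; last by apply/implyP => _; lra.
  by congr (_ * _); rewrite mulrC powRrM powR_mulrn ?powR_ge0.
set t := h `^ (8 / 11 + eps) in tV *.
have [K0 K_le K_ge] := cutoff_bounds R V V1.
set K := Num.truncn _ in K0 K_le K_ge.
have e1 : 1 <= h `^ eps by rewrite -[leLHS](powRr0 h) ler_powR // ltW.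
have V8 : 1 <= V ^+ 8 by rewrite exprn_ege1.
have V4 : 1 <= V ^+ 4 by rewrite exprn_ege1.
have V7 : 0 <= V ^+ 7 by rewrite exprn_ge0 //; lra.
have t_ge : V ^+ 8 <= t by rewrite tV ler_peMr //; lra.
have t0 : 0 < t by lra.
have sK0 : 0 < Num.sqrt K%:R :> R by lra.
have hK : h / Num.sqrt K%:R <= 2 * V ^+ 7.
  rewrite ler_pdivrMr // hV (_ : V ^+ 11 = 2 * V ^+ 7 * (V ^+ 4 / 2)); last by field.
  by rewrite ler_wpM2l // mulr_ge0.
have V78 : V ^+ 7 <= V ^+ 8 by rewrite ler_weXn2l.
have X_ge0 : 0 <= X by lra.
apply: (le_trans (lebesgue_measure_le_subset _ _ _ _)
  (le_trans (measure_Q_increment R K X h t K0 X_ge0 h0 t0) _)).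
  move=> x /= [Xx far]; split=> // near_x; apply: far.
  have x0 : 0 <= x by case/andP: Xx => ? _; lra.
  rewrite (_ : x + _ = (Num.sqrt x + h) ^+ 2); last by rewrite sqrrD sqr_sqrtr //; ring.
  apply: le_trans near_x _; rewrite -mulrA; lra.
rewrite lee_fin.
have r_le : (Num.sqrt (2 * X) + h) ^+ 2 <= 6 * X.
  have hh : h ^+ 2 <= X by rewrite -[leRHS]sqr_sqrtr // ler_sqr ?nnegrE ?sqrtr_ge0.
  have := sqr_sqrtr (mulr_ge0 (ler0n R 2) X_ge0).
  have := sqr_ge0 (Num.sqrt (2 * X) - h); nra.
(* [96 = 8 * 2 * 6], from the measure bound, [hK] and [r_le]. *)
have tE : 96 * V ^+ 8 <= d * t.
  rewrite tV (mulrCA d) (mulrC 96) ler_wpM2l ?(le_trans ler01) //.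
  by rewrite (mulrC d) -ler_pdivrMr.
rewrite invfM mulrA ler_pdivrMr //.
rewrite (_ : 8 * h * _ / _ = 8 * (h / Num.sqrt K%:R) * (Num.sqrt (2 * X) + h) ^+ 2); last by ring.
apply: (@le_trans _ _ (8 * (2 * V ^+ 7) * (6 * X))).
  apply: ler_pM; [|exact: sqr_ge0| |exact: r_le].
    by rewrite mulr_ge0 // divr_ge0 // ltW.
  by rewrite ler_wpM2l.
rewrite (_ : 8 * _ * _ = X * (96 * V ^+ 7)); last by ring.
rewrite mulrAC (mulrC _ X) ler_wpM2l //; lra.
Unshelve. all: by end_near. Qed.
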